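(* For every integer $k\ge 2$ there exists a latin square of order $2k$ which contains two disjoint indivisible $k$-plexes.
   Context: A latin square of order $n$ is an $n\times n$ array of $n$ symbols in which each symbol occurs exactly once in each row and column. A $k$-plex in a latin square of order $n$ is a set of $kn$ cells containing exactly $k$ cells from each row, exactly $k$ cells from each column, and exactly $k$ occurrences of each symbol. A $k$-plex is indivisible if it contains no $c$-plex (of the same latin square) for any $c$ with $0<c<k$. *)

(* Defs.v *)
From mathcomp Require Import all_boot.
Set Implicit Arguments. Unset Strict Implicit. Unset Printing Implicit Defensive.

Definition latin_square (n : nat) (L : 'I_n -> 'I_n -> 'I_n) : Prop :=
  (forall r, injective (L r)) /\ (forall c, injective (fun r => L r c)).

Definition is_plex (n : nat) (L : 'I_n -> 'I_n -> 'I_n) (k : nat)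
    (P : {set 'I_n * 'I_n}) : Prop :=
  [/\ forall r : 'I_n, #|[set x in P | x.1 == r]| = k,
      forall c : 'I_n, #|[set x in P | x.2 == c]| = k
    & forall s : 'I_n, #|[set x in P | L x.1 x.2 == s]| = k].

Definition indivisible_plex (n : nat) (L : 'I_n -> 'I_n -> 'I_n) (k : nat)
    (P : {set 'I_n * 'I_n}) : Prop :=
  is_plex L k P /\
  forall (c : nat) (Q : {set 'I_n * 'I_n}),
    0 < c < k -> Q \subset P -> ~ is_plex L c Q.

(* Main.v *)
Require Import Defs.
From mathcomp Require Import all_boot all_fingroup all_algebra zify.
Set Implicit Arguments. Unset Strict Implicit. Unset Printing Implicit Defensive.
Import GRing.Theory.

(** Give rows, columns and symbols weights f, g, h in Z_k and suppose that
    f(r) + g(c) = h(s) on every cell of a k-plex P.  Summing over a c-plex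
    inside P gives c * (sum h - sum f - sum g) = 0, so if the total
    sum h - sum f - sum g is 1 or -1 then k divides c and P is indivisible.

    Rows, columns and symbols are Z_k x {0,1}, with the first coordinate as
    weight of rows and columns.  The square is the Cayley table of Z_k x Z_2
    (up to exchanging the two symbols in some of its 2 x 2 subsquares), except
    that in the blocks i + j = 0 and i + j = 1 the cells with bits (1,0) trade
    their symbols (1,1) and (0,1).  The symbol (0,1) then occurs off the
    diagonal of blocks of both classes, and so does (1,1).  P takes those two
    symbols only in the blocks of class 1 and its complement only in those of
    class 0; weighting them 1 for P and 0 for the complement changes the total
    weight from 0 to 1 and to -1 respectively.

    For even k, P may depend only on i + j and the two bits.  For odd k the sum
    of all bits over P obstructs this, so the blocks of class 2 are twisted and
    the rows i = -1, 0, 1 are treated separately. *)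

Definition disjoint_indivisible_plexes (k : nat) : Prop :=
  exists (L : 'I_(2 * k) -> 'I_(2 * k) -> 'I_(2 * k))
         (P1 P2 : {set 'I_(2 * k) * 'I_(2 * k)}),
    [/\ latin_square L, indivisible_plex L k P1, indivisible_plex L k P2
      & [disjoint P1 & P2]].

(** * Weight sums, cell counts and complements *)

Lemma plex_weight_sum (V : zmodType) (n c : nat) (L : 'I_n -> 'I_n -> 'I_n)
    (Q : {set 'I_n * 'I_n}) (f g h : 'I_n -> V) :
  is_plex L c Q ->
  (forall x, x \in Q -> f x.1 + g x.2 = h (L x.1 x.2))%R ->
  ((\sum_r f r + \sum_r g r) *+ c = (\sum_r h r) *+ c)%R.
Proof.
case=> Qr Qc Qs Qw.
have fiber (u : 'I_n * 'I_n -> 'I_n) (w : 'I_n -> V) :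
    (forall r, #|[set x in Q | u x == r]| = c) ->
    (\sum_(x in Q) w (u x) = (\sum_r w r) *+ c)%R.
  move=> Hu; rewrite (partition_big u xpredT) //= -sumrMnl; apply: eq_bigr => r _.
  rewrite -(Hu r) -sumr_const; apply: eq_big => [x|x /andP[_ /eqP->]] //.
  by rewrite inE.
rewrite mulrnDl -(fiber fst f Qr) -(fiber snd g Qc).
by rewrite -(fiber (fun x => L x.1 x.2) h Qs) -big_split; apply: eq_bigr.
Qed.

Lemma card_pair_set (I J : finType) (p : I -> J -> bool) :
  #|[set x : I * J | p x.1 x.2]| = \sum_i \sum_j p i j.
Proof.
by rewrite cardsE -sum1_card big_mkcond pair_big; apply: eq_bigr => -[i j].
Qed.

Lemma sum_nat_eq1 (I : finType) (y : I) : \sum_(x : I) (x == y : nat) = 1.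
Proof.
by rewrite (bigD1 y) //= eqxx big1 ?addn0 // => x /negPf->.
Qed.

Lemma sum_inj_eq1 (I : finType) (f : I -> I) (y : I) :
  injective f -> \sum_(x : I) (f x == y : nat) = 1.
Proof.
move=> /injF_bij [g fK gK]; rewrite -(sum_nat_eq1 (g y)).
by apply: eq_bigr => x _; rewrite -(inj_eq (can_inj gK)) fK.
Qed.

(** Each row, column and symbol of the square has [2 * k] cells in all, so removing [k] of them
    leaves [k]. *)
Lemma plex_setC (k : nat) (L : 'I_(2 * k) -> 'I_(2 * k) -> 'I_(2 * k))
    (P : {set 'I_(2 * k) * 'I_(2 * k)}) :
  latin_square L -> is_plex L k P -> is_plex L k (~: P).
Proof.
case=> Lr _ [Pr Pc Ps].
have compl (A : {set 'I_(2 * k) * 'I_(2 * k)}) (q : pred ('I_(2 * k) * 'I_(2 * k))) :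
    #|[set x | q x]| = 2 * k -> #|[set x in A | q x]| = k -> #|[set x in ~: A | q x]| = k.
  have := cardsID A [set x | q x].
  rewrite (_ : _ :&: A = [set x in A | q x]); last by apply/setP=> x; rewrite !inE andbC.
  rewrite (_ : _ :\: A = [set x in ~: A | q x]); last by apply/setP=> x; rewrite !inE.
  by move=> + cq cA; rewrite cq cA; lia.
split=> s; apply: compl => //.
- rewrite (card_pair_set (fun i j => i == s)) exchange_big /=.
  by under eq_bigr do rewrite sum_nat_eq1; rewrite sum_nat_const card_ord muln1.
- rewrite (card_pair_set (fun i j => j == s)).
  by under eq_bigr do rewrite sum_nat_eq1; rewrite sum_nat_const card_ord muln1.
- rewrite (card_pair_set (fun i j => L i j == s)).
  by under eq_bigr do rewrite sum_inj_eq1 //; rewrite sum_nat_const card_ord muln1.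
Qed.

(** Parities alternate from the even index [0], so an odd [n] leaves one surplus even index. The
    doubling counts the two cells of a block that takes its whole row of bit [odd l]. *)
Lemma sum_parity (n : nat) (a : bool) :
  \sum_(l < n) (odd l == a).*2 = (if odd n then if a then n.-1 else n.+1 else n).
Proof.
elim: n => [|n IHn]; first by rewrite big_ord0.
rewrite big_ord_recr /= {}IHn; case: n => [|n] /=; first by case: a.
by case: (odd n) => /=; case: a => /=; rewrite ?eqxx /=; lia.
Qed.

(** * The square and its two plexes from given [pi] and [phi] *)

Section Construction.

Variable m : nat.
Local Notation k := m.+2.
Local Notation Z := 'I_k.
Local Notation T := (Z * bool)%type.

Definition tau (a b : bool) (l : Z) : Z := if a && ~~ b then tperm 0%R 1%R l else l.

Lemma tauK a b : involutive (tau a b).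
Proof. by move=> l; rewrite /tau; case: (_ && _); rewrite ?tpermK. Qed.

(* [pi i l a b]: the plex contains the cell in row [(i, a)] and column
   [(l - i, b)].  [phi i l]: the block in row class [i] and diagonal [l] has
   its two symbols exchanged. *)
Variables (pi : Z -> Z -> bool -> bool -> bool) (phi : Z -> Z -> bool).

Definition sq (r c : T) : T :=
  let l := (r.1 + c.1)%R in (tau r.2 c.2 l, r.2 (+) c.2 (+) phi r.1 l).

Definition cells (r c : T) : bool := pi r.1 (r.1 + c.1)%R r.2 c.2.

Hypothesis phi0 : forall i, phi i 0%R = false.
Hypothesis phi1 : forall i, phi i 1%R = false.

(** [tau] moves only [0] and [1], where [phi] vanishes. A constant [f] serves a fixed row, [l - j] a
    fixed column. *)
Lemma phi_tau (f : Z -> Z) a b l : phi (f (tau a b l)) (tau a b l) = phi (f l) l.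
Proof.
rewrite /tau; case: ifP => _ //.
by case: tpermP => // ->; rewrite phi0 phi1.
Qed.

Lemma sq_row_inj r : injective (sq r).
Proof.
case: r => i a [j b] [j' b'] [/= El Eb].
have Ebb : b = b'.
  move: Eb; rewrite -(phi_tau (fun=> i) a b) El (phi_tau (fun=> i)).
  by case: a b b' (phi _ _) {El} => -[] [] [].
by move: El; rewrite -Ebb => /(can_inj (tauK _ _)) /addrI ->.
Qed.

Lemma sq_col_inj c : injective (fun r => sq r c).
Proof.
case: c => j b [i a] [i' a'] [/= El Eb].
have Eaa : a = a'.
  have Ep : phi i (i + j)%R = phi i' (i' + j)%R.
    rewrite -{1}(addrK j i) -{1}(addrK j i') -(phi_tau (fun l => l - j)%R a b) El.
    by rewrite (phi_tau (fun l => l - j)%R).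
  by move: Eb; rewrite Ep; case: a a' b (phi _ _) {Ep El} => -[] [] [].
by move: El; rewrite -Eaa => /(can_inj (tauK _ _)) /addIr ->.
Qed.

Hypothesis pi0 : forall i a, pi i 0%R a (~~ a) = false.
Hypothesis pi1 : forall i a, pi i 1%R a (~~ a) = true.
Hypothesis row_count : forall i a, \sum_l \sum_b pi i l a b = k.
Hypothesis col_count : forall (j : Z) b, \sum_l \sum_a pi (l - j)%R l a b = k.
Hypothesis sym_count : forall t (e : bool),
  \sum_i \sum_a \sum_b (pi i (tau a b t) a b && (a (+) b (+) phi i t == e)) = k.

Lemma cells_row r : \sum_c cells r c = k.
Proof.
case: r => i a; transitivity (\sum_l \sum_b pi i l a b); last exact: row_count.
rewrite [RHS](reindex (fun j => i + j)%R) /=; last first.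
  by exists (fun l => - i + l)%R => j _; rewrite addrA ?addNr ?subrr add0r.
by rewrite pair_big; apply: eq_bigr => -[].
Qed.

Lemma cells_col c : \sum_r cells r c = k.
Proof.
case: c => j b; transitivity (\sum_l \sum_a pi (l - j)%R l a b); last exact: col_count.
rewrite [RHS](reindex (fun i => i + j)%R) /=; last first.
  by exists (fun l => l - j)%R => i _; rewrite ?addrK ?subrK.
by rewrite pair_big; apply: eq_bigr => -[i a] _; rewrite /= addrK.
Qed.

(** With row and column bit fixed, first coordinate [t] occurs only on the diagonal [tau a b t], so
    the sum over diagonals collapses to the term in [sym_count]. *)
Lemma cells_sym s : \sum_r \sum_c (cells r c && (sq r c == s)) = k.
Proof.
case: s => t e; apply: etrans (sym_count t e).
rewrite pair_big [RHS]pair_big /=.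
transitivity (\sum_(r : T) \sum_b \sum_(l : Z)
   (pi r.1 l r.2 b && ((tau r.2 b l, r.2 (+) b (+) phi r.1 l) == (t, e)))).
  rewrite -(pair_big xpredT xpredT (fun (r c : T) => (cells r c && (sq r c == (t, e)) : nat))) /=.
  apply: eq_bigr => -[i a] _ /=; rewrite exchange_big /=.
  rewrite [RHS](reindex (fun j => i + j)%R) /=; last first.
    by exists (fun l => - i + l)%R => j _; rewrite addrA ?addNr ?subrr add0r.
  by rewrite pair_big; apply: eq_bigr => -[].
apply: eq_bigr => -[i a] _ /=; apply: eq_bigr => b _.
rewrite (bigD1 (tau a b t)) //= tauK xpair_eqE eqxx big1 ?addn0 /=.
  by rewrite (phi_tau (fun=> i)).
move=> l /negPf lt; rewrite xpair_eqE -[t in _ == t](tauK a b).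
by rewrite (can_eq (tauK a b)) lt andbF.
Qed.

(** Negation permutes [Z], so the sum is its own opposite. For even [k] the single sum is not zero;
    the two bits supply the doubling in [sum_fst]. *)
Lemma sumZ_double : (\sum_(i : Z) i + \sum_(i : Z) i = 0)%R.
Proof.
rewrite {1}(reindex_inj (@oppr_inj Z)) /= -big_split /=.
by rewrite big1 // => i _; rewrite addNr.
Qed.

Lemma sum_fst : (\sum_(x : T) x.1 = 0)%R.
Proof.
rewrite -(pair_big xpredT xpredT (fun (i : Z) (_ : bool) => i)) /=.
under eq_bigr do rewrite big_bool.
by rewrite big_split; exact: sumZ_double.
Qed.

Definition weight_in (s : T) : Z := (s.1 + (s == (0, true))%:R)%R.
Definition weight_out (s : T) : Z := (s.1 - (s == (1, true))%:R)%R.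

Lemma sum_weight_in : (\sum_s weight_in s = 1)%R.
Proof. by rewrite big_split /= sum_fst add0r -natr_sum sum_nat_eq1. Qed.

Lemma sum_weight_out : (\sum_s weight_out s = -1)%R.
Proof. by rewrite sumrB sum_fst sub0r -natr_sum sum_nat_eq1. Qed.

(** Symbol [(0, true)] lies at bits (0,1) of class 0, excluded by [pi0], and at bits (1,0) of class
    1, where the raised weight 1 is the correct one. *)
Lemma weight_in_cells r c : cells r c -> (r.1 + c.1 = weight_in (sq r c))%R.
Proof.
case: r c => [i a] [j b]; rewrite /cells /weight_in /sq /= xpair_eqE eqb_id.
move: (i + j)%R => l; have [<-|ab] := eqVneq a b.
  rewrite /tau andbN addbb addFb.
  by case: eqP => [->|_]; rewrite ?phi0 /= addr0.
have {ab}-> : b = ~~ a by case: a b ab => -[].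
have [->|l0] := eqVneq l 0%R; first by rewrite pi0.
have [->|l1] := eqVneq l 1%R => [_|_].
  by rewrite phi1 /tau negbK andbb; case: a; rewrite ?tpermR /= ?add0r ?addr0.
have -> : tau a (~~ a) l = l.
  by rewrite /tau; case: ifP => // _; rewrite tpermD // eq_sym.
by rewrite (negPf l0) addr0.
Qed.

(** Dually, [pi1] leaves [(1, true)] outside the plex only at bits (1,0) of class 0, where the
    lowered weight 0 is correct. *)
Lemma weight_out_cells r c : ~~ cells r c -> (r.1 + c.1 = weight_out (sq r c))%R.
Proof.
case: r c => [i a] [j b]; rewrite /cells /weight_out /sq /= xpair_eqE eqb_id.
move: (i + j)%R => l; have [<-|ab] := eqVneq a b.
  rewrite /tau andbN addbb addFb.
  by case: eqP => [->|_]; rewrite ?phi1 /= subr0.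
have {ab}-> : b = ~~ a by case: a b ab => -[].
have [->|l1] := eqVneq l 1%R; first by rewrite pi1.
have [->|l0] := eqVneq l 0%R => [_|_].
  by rewrite phi0 /tau negbK andbb; case: a; rewrite ?tpermL /= ?subrr ?subr0.
have -> : tau a (~~ a) l = l.
  by rewrite /tau; case: ifP => // _; rewrite tpermD // eq_sym.
by rewrite (negPf l1) subr0.
Qed.

Lemma construction_plexes : disjoint_indivisible_plexes k.
Proof.
have cardT : #|{: T}| = 2 * k by rewrite card_prod card_ord card_bool mulnC.
pose d (r : 'I_(2 * k)) : T := enum_val (cast_ord (esym cardT) r).
pose e (x : T) : 'I_(2 * k) := cast_ord cardT (enum_rank x).
have dK : cancel d e by move=> r; rewrite /e /d enum_valK cast_ordKV.
have eK : cancel e d by move=> x; rewrite /e /d cast_ordK enum_rankK.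
have sum_d (R : nmodType) (F : T -> R) : (\sum_r F (d r) = \sum_x F x)%R.
  by rewrite [RHS](reindex d) //; exists e.
have sumn_d (F : T -> nat) : \sum_r F (d r) = \sum_x F x.
  by rewrite [RHS](reindex d) //; exists e.
pose L r c := e (sq (d r) (d c)).
pose P : {set 'I_(2 * k) * 'I_(2 * k)} := [set x | cells (d x.1) (d x.2)].
have latL : latin_square L.
  split=> [r c c'|c r r'] /(can_inj eK).
    by move/sq_row_inj/(can_inj dK).
  by move/sq_col_inj/(can_inj dK).
have plexP : is_plex L k P.
  split=> s.
  - rewrite (_ : [set x in P | _] = [set x | cells (d x.1) (d x.2) && (x.1 == s)]); last first.
      by apply/setP=> x; rewrite !inE.
    rewrite (card_pair_set (fun r c => cells (d r) (d c) && (r == s))).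
    rewrite (bigD1 s) //= [X in _ + X]big1 ?addn0 => [|r /negPf->]; last first.
      by rewrite big1 // => c _; rewrite andbF.
    rewrite -[RHS](cells_row (d s)) -sumn_d.
    by apply: eq_bigr => c _; rewrite eqxx andbT.
  - rewrite (_ : [set x in P | _] = [set x | cells (d x.1) (d x.2) && (x.2 == s)]); last first.
      by apply/setP=> x; rewrite !inE.
    rewrite (card_pair_set (fun r c => cells (d r) (d c) && (c == s))) exchange_big.
    rewrite (bigD1 s) //= [X in _ + X]big1 ?addn0 => [|r /negPf->]; last first.
      by rewrite big1 // => c _; rewrite andbF.
    rewrite -[RHS](cells_col (d s)) -sumn_d.
    by apply: eq_bigr => c _; rewrite eqxx andbT.
  - rewrite (_ : [set x in P | _] =
      [set x | cells (d x.1) (d x.2) && (sq (d x.1) (d x.2) == d s)]); last first.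
      by apply/setP=> x; rewrite !inE -(inj_eq (can_inj dK)) eK.
    rewrite (card_pair_set (fun r c => cells (d r) (d c) && (sq (d r) (d c) == d s))).
    rewrite -[RHS](cells_sym (d s)) -sumn_d; apply: eq_bigr => r _.
    by rewrite -(sumn_d (fun c => cells (d r) c && (sq (d r) c == d s) : nat)).
have indiv (A : {set 'I_(2 * k) * 'I_(2 * k)}) (w : T -> Z) :
    (\sum_s w s = 1 \/ \sum_s w s = -1)%R ->
    (forall x, x \in A -> (d x.1).1 + (d x.2).1 = w (sq (d x.1) (d x.2)))%R ->
    is_plex L k A -> indivisible_plex L k A.
  move=> sw wA plexA; split=> // c Q /andP[c0 ck] /subsetP QA plexQ.
  have := plex_weight_sum (f := fun r => (d r).1) (g := fun r => (d r).1)
    (h := fun r => w (d r)) plexQ.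
  rewrite !sum_d sum_fst addr0 mul0rn => wsum.
  have {}wsum : ((\sum_s w s) *+ c = 0)%R.
    by rewrite -wsum // => x /QA /wA ->; rewrite eK.
  have {}wsum : (c%:R = 0 :> Z)%R.
    case: sw wsum => -> // /eqP.
    by rewrite mulNrn oppr_eq0 => /eqP.
  move/(congr1 val): wsum; rewrite Zp_nat /= modn_small // => c00.
  by rewrite c00 in c0.
exists L, P, (~: P); split=> //; last by rewrite -setI_eq0 setICr.
- apply: (indiv _ weight_in) => //; first by left; apply: sum_weight_in.
  by move=> x; rewrite inE => /weight_in_cells.
- apply: (indiv _ weight_out); first by right; apply: sum_weight_out.
    by move=> x; rewrite !inE => /weight_out_cells.
  exact: plex_setC.
Qed.

End Construction.

(** * Explicit tables for even and odd [k] *)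

(** Corrects a generic count on the few exceptional classes [s]; the additive form avoids truncated
    subtraction and suits [lia]. *)
Lemma sum_agree (I : finType) (s : seq I) (F G : I -> nat) :
  uniq s -> (forall x, x \notin s -> F x = G x) ->
  \sum_x F x + \sum_(x <- s) G x = \sum_x G x + \sum_(x <- s) F x.
Proof.
move=> us FG.
have split_s (H : I -> nat) :
    \sum_x H x = \sum_(x <- s) H x + \sum_(x | x \notin s) H x.
  by rewrite (bigID (mem s)) /= -big_uniq.
by rewrite (split_s F) (split_s G) (eq_bigr G FG) addnC [X in _ + X = _]addnC addnA.
Qed.

Lemma natr_ord_eq0 (m p : nat) : p < m.+2 -> (p%:R == 0 :> 'I_m.+2)%R = (p == 0).
Proof. by move=> pm; rewrite Zp_nat -val_eqE /= modn_small. Qed.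

Lemma plexes_even (m : nat) : ~~ odd m -> disjoint_indivisible_plexes m.+2.
Proof.
move=> evm; set Z := 'I_m.+2.
(* Classes 0 and 1 take one and three cells, together giving 2 to every row and column; each other
   block takes one full row, and even [k] balances the two row bits. *)
pose pi (i l : Z) (a b : bool) :=
  if l == 0%R then ~~ a && ~~ b else if l == 1%R then a || b else odd l == a.
have us : uniq [:: 0; 1 : Z]%R by [].
have z10 : (1 == 0 :> Z)%R = false by rewrite oner_eq0.
apply: (@construction_plexes m pi (fun _ _ => false)) => //.
- by move=> i [].
- by move=> i []; rewrite /pi z10 eqxx.
- move=> i a.
  have FG (l : Z) : l \notin [:: 0; 1]%R -> \sum_b pi i l a b = (odd l == a).*2.
    by rewrite !inE negb_or big_bool /pi => /andP[/negPf-> /negPf->]; rewrite /= addnn.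
  have := sum_agree us FG; move: (\sum_l _) => S.
  rewrite sum_parity /= negbK (negPf evm) !big_cons !big_nil !big_bool /pi !z10 !eqxx.
  by case: a {FG} => /=; clear; lia.
- move=> j b.
  have FG (l : Z) : l \notin [:: 0; 1]%R -> \sum_a pi (l - j)%R l a b = 1.
    rewrite !inE negb_or big_bool /pi => /andP[/negPf-> /negPf->].
    by case: (odd l).
  have := sum_agree us FG; move: (\sum_l _) => S.
  rewrite sum_nat_const card_ord muln1 !big_cons !big_nil !big_bool /pi !z10 !eqxx.
  by case: b {FG} => /=; clear; lia.
(* Each row class [i] contributes exactly one occurrence of the symbol. *)
- move=> t e; rewrite -[RHS]card_ord -[RHS]muln1 -sum_nat_const; apply: eq_bigr => i _.
  rewrite !big_bool /tau /=.
  have [->|t0] := eqVneq t 0%R.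
    by rewrite tpermL /pi z10 !eqxx; case: e.
  have [->|t1] := eqVneq t 1%R.
    by rewrite tpermR /pi z10 !eqxx; case: e.
  by rewrite tpermD 1?eq_sym // /pi (negPf t0) (negPf t1); case: e (odd t) => -[].
Qed.

Lemma plexes_odd (n : nat) : ~~ odd n -> disjoint_indivisible_plexes n.+3.
Proof.
move=> evn; set Z := 'I_n.+3.
(* [v], [w], [u] fill classes 0, 1, 2. The other blocks give [k - 3] cells to every row and column,
   so these three must give 3. *)
pose v (i : Z) (a b : bool) :=
  (a == b) && (if i == -1 then false else (i == 0) || ~~ a)%R.
pose w (i : Z) (a b : bool) :=
  (a != b) || (if i == -1 then true else (i != 1) && a)%R.
pose u (i : Z) (a b : bool) :=
  (if i == 0 then ~~ a && b else if i == 1 then a || ~~ b else a == b)%R.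
pose pi (i l : Z) (a b : bool) :=
  (if l == 0 then v i a b else if l == 1 then w i a b else
   if l == 1 + 1 then u i a b else odd l == a)%R.
have z10 : (1 == 0 :> Z)%R = false by rewrite oner_eq0.
have z20 : (1 + 1 == 0 :> Z)%R = false by apply: (@natr_ord_eq0 n.+1 2).
have z21 : (1 + 1 == 1 :> Z)%R = false by rewrite -subr_eq0 addrK.
have z02 : (0 == 1 + 1 :> Z)%R = false by rewrite eq_sym.
have z12 : (1 == 1 + 1 :> Z)%R = false by rewrite eq_sym.
have zm0 : (-1 == 0 :> Z)%R = false by rewrite oppr_eq0 z10.
have zm1 : (-1 == 1 :> Z)%R = false by rewrite eq_sym -subr_eq0 opprK z20.
have z01 : (0 == 1 :> Z)%R = false by rewrite eq_sym.
have us : uniq [:: 0; 1; (1 + 1)%R : Z]%R.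
  by rewrite cons_uniq !inE ![(0 == _)%R]eq_sym z10 z20 cons_uniq !inE eq_sym z21.
(* Generic [u] takes two cells with equal symbols; twisting for odd [i] spreads these over both
   symbols of class 2. *)
apply: (@construction_plexes n.+1 pi (fun i l => (l == 1 + 1)%R && odd i)).
- by move=> i; rewrite eq_sym z20.
- by move=> i; rewrite eq_sym z21.
- by move=> i []; rewrite /pi eqxx.
- by move=> i []; rewrite /pi z10 eqxx.
- move=> i a.
  have FG (l : Z) : l \notin [:: 0; 1; (1 + 1)%R]%R -> \sum_b pi i l a b = (odd l == a).*2.
    rewrite !inE !negb_or big_bool /pi => /and3P[/negPf-> /negPf-> /negPf->].
    by rewrite /= addnn.
  have := sum_agree us FG => {FG}; move: (\sum_l _) => S.
  rewrite sum_parity /= negbK (negPf evn) !big_cons !big_nil !big_bool /pi !z10 !z20 !z21 !eqxx.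
  have -> : odd (1 + 1 : Z)%R = false by [].
  rewrite /v /w /u.
  have [->|im] := eqVneq i (-1)%R; first by rewrite !zm0 zm1; case: a => /=; clear; lia.
  have [->|i0] := eqVneq i 0%R; first by rewrite z01; case: a => /=; clear; lia.
  by have [_|_] := eqVneq i 1%R; case: a => /=; clear; lia.
- move=> j b.
  have FG (l : Z) : l \notin [:: 0; 1; (1 + 1)%R]%R -> \sum_a pi (l - j)%R l a b = 1.
    rewrite !inE !negb_or big_bool /pi => /and3P[/negPf-> /negPf-> /negPf->].
    by case: (odd l) b => -[].
  have := sum_agree us FG => {FG}; move: (\sum_l _) => S.
  rewrite sum_nat_const card_ord muln1 !big_cons !big_nil !big_bool /pi !z10 !z20 !z21 !eqxx.
  rewrite /v /w /u sub0r; move: (- j)%R => t.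
  (* A column meets [v], [w], [u] in row classes [t], [1 + t], [1 + 1 + t]. Aligning the tests
     leaves as special only [t] equal to -1, 0 or -2. *)
  have -> : (1 + t == -1)%R = (1 + 1 + t == 0 :> Z)%R.
    by rewrite -[RHS](inj_eq (addrI (-1)%R)) addr0 addrA addKr.
  have -> : (1 + t == 1)%R = (t == 0 :> Z)%R by rewrite -{2}[1%R]addr0 (inj_eq (addrI _)).
  have -> : (1 + 1 + t == 1)%R = (t == -1 :> Z)%R.
    by rewrite -addrA -{3}[1%R]addr0 (inj_eq (addrI _)) addrC addr_eq0.
  have [->|tm] := eqVneq t (-1)%R.
    by rewrite zm0 addrK z10; case: b => /=; clear; lia.
  have [->|t0] := eqVneq t 0%R; first by rewrite addr0 z20; case: b => /=; clear; lia.
  by case: (1 + 1 + t == 0)%R; case: b => /=; clear; lia.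
- move=> t e.
  have sc : \sum_(i : Z) 1 = n.+3 by rewrite sum_nat_const card_ord muln1.
  under eq_bigr do rewrite !big_bool /tau /=.
  have [->|t0] := eqVneq t 0%R.
    under eq_bigr do rewrite tpermL /pi z10 z02 !eqxx /v /w.
    case: e.
      apply: etrans sc; apply: eq_bigr => i _ /=.
      by case: (i == -1)%R (i == 0)%R => -[].
    (* Symbol [(0, false)] occurs once per row class, except never for [i = -1] and twice for
       [i = 0]. *)
    apply: (@addIn (\sum_(i : Z) (i == -1)%R)).
    apply: (etrans (y := \sum_(i : Z) (1 + (i == 0)%R))); last first.
      by rewrite big_split /= sc !sum_nat_eq1.
    rewrite -big_split; apply: eq_bigr => i _ /=.
    by have [->|im] := eqVneq i (-1)%R; rewrite ?zm0 //=; case: (i == _).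
  have [->|t1] := eqVneq t 1%R.
    under eq_bigr do rewrite tpermR /pi z10 z12 !eqxx /v /w.
    case: e.
      apply: etrans sc; apply: eq_bigr => i _ /=.
      by case: (i == -1)%R (i == 1)%R => -[].
    (* Here the exceptions are none for [i = 1] and two for [i = -1]. *)
    apply: (@addIn (\sum_(i : Z) (i == 1)%R)).
    apply: (etrans (y := \sum_(i : Z) (1 + (i == -1)%R))); last first.
      by rewrite big_split /= sc !sum_nat_eq1.
    rewrite -big_split; apply: eq_bigr => i _ /=.
    by have [->|im] := eqVneq i (-1)%R; rewrite ?zm1 //=; case: (i == _).
  rewrite tpermD 1?eq_sym // /pi (negPf t0) (negPf t1).
  have [t2|t2] := eqVneq t (1 + 1)%R; last first.
    apply: etrans sc; apply: eq_bigr => i _ /=; by case: e (odd t) => -[].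
  (* Twisted pairs alone would give [k - 1] odd and [k + 1] even symbols. Row class 0 trades two
     even for one odd, and row class 1 adds one even. *)
  have := sum_parity n.+3 e; rewrite /= negbK (negPf evn) /= => sp.
  case: e sp => sp.
    apply: (etrans (y := \sum_(i : Z) ((odd i == true).*2 + (i == 0)%R))); last first.
      by rewrite big_split /= sp sum_nat_eq1 addn1.
    apply: eq_bigr => i _ /=; rewrite /u.
    have [->|i0] := eqVneq i 0%R; first by [].
    by have [->|i1] := eqVneq i 1%R; [|case: (odd i)].
  apply: (@addIn (\sum_(i : Z) (i == 0)%R.*2)).
  apply: (etrans (y := \sum_(i : Z) ((odd i == false).*2 + (i == 1)%R))); last first.
    rewrite big_split /= sp sum_nat_eq1.
    rewrite (bigD1 (0%R : Z)) //= big1 => [|i /negPf->] //; clear; lia.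
  rewrite -big_split; apply: eq_bigr => i _ /=; rewrite /u.
  have [->|i0] := eqVneq i 0%R; first by rewrite z01.
  by have [->|i1] := eqVneq i 1%R; [|case: (odd i)].
Qed.

Theorem theorem5p4 (k : nat) : 2 <= k ->
  exists (L : 'I_(2 * k) -> 'I_(2 * k) -> 'I_(2 * k))
         (P1 P2 : {set 'I_(2 * k) * 'I_(2 * k)}),
    [/\ latin_square L, indivisible_plex L k P1, indivisible_plex L k P2
      & [disjoint P1 & P2]].
Proof.
case: k => [|[|m]] // _.
have [om|em] := boolP (odd m); last exact: plexes_even.
by case: m om => // n /= en; apply: plexes_odd.
Qed.
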